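(* Let $N\ge1$, let $\beta_1,\beta_2,\alpha_1,\dots,\alpha_N$ be real and let $p,x_1,\dots,x_N$ be nonzero real numbers. Let $e_k(p)=e_k(p,x_1,\dots,x_N)$ be the coefficients of the polynomial $$W(t)=(\beta_1+1)(1-t)\prod_{j=1}^N(1-x_jt)-(\beta_2+1)\,t\prod_{j=1}^N(1-x_jt)-\sum_{l=1}^N(\alpha_l+1)x_l\,t(1-t)\prod_{j\ne l}(1-x_jt)$$ expanded in powers of $u=1-pt$, i.e. $W(t)=\sum_{k=0}^{N+1}e_k(p)u^k$. Then for $k=0,\dots,N+1$, $$e_k(p)=\frac{1}{p^{N+1}}\,x_1\cdots x_N\left[(\beta_1+1)v_k(p)+(\beta_2+1)w_k(p)+\sum_{l=1}^N(\alpha_l+1)x_l\,z_{k,l}(p)\right],$$ where $$v_k(p)=\sigma_{N+1-k}\Bigl(p-1,\bigl(\tfrac{p-x_j}{x_j}\bigr)_{j=1,\dots,N}\Bigr),\qquad w_k(p)=\sigma_{N+1-k}\Bigl(-1,\bigl(\tfrac{p-x_j}{x_j}\bigr)_{j=1,\dots,N}\Bigr),$$ $$z_{k,l}(p)=\sigma_{N+1-k}\Bigl(-1,p-1,\bigl(\tfrac{p-x_j}{x_j}\bigr)_{j\ne l}\Bigr).$$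
   Context: $\sigma_l(y_1,\dots,y_k)$ is the $l$-th elementary symmetric polynomial in $k$ variables, with $\sigma_0=1$ (also for $k=0$) and $\sigma_l=0$ if $l<0$ or $l>k$.
   Formalization: The last sum in the formula for e_k(p) is corrected to the sum of (α_l+1) z_{k,l}(p), without the printed factor x_l; as printed it fails for N=1, x_1=2, p=1, α_1=0, β_1=β_2=−1, k=2 (gives 4, but e_2=2). *)

(* Defs.v *)
From mathcomp Require Import all_boot all_order all_algebra.
From mathcomp Require Import reals mpoly.

Set Implicit Arguments.
Unset Strict Implicit.
Unset Printing Implicit Defensive.

Import Order.TTheory GRing.Theory Num.Theory.
Local Open Scope ring_scope.

(* [mesym] already yields 1 for l = 0 (also on the empty list) and 0 for
   l > size y.  The indices N + 1 - k with k <= N + 1 are never negative, so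
   l : nat and truncated subtraction are enough. *)
Definition sigma (R : realType) (l : nat) (y : seq R) : R :=
  (mesym (size y) R l).@[fun i => y`_i].

Section Expansion.

Variables (R : realType) (N : nat) (beta1 beta2 : R).
Variables (alpha x : 'I_N -> R) (p : R).

Definition W : {poly R} :=
  (beta1 + 1) *: ((1 - 'X) * \prod_(j < N) (1 - x j *: 'X))
  - (beta2 + 1) *: ('X * \prod_(j < N) (1 - x j *: 'X))
  - \sum_(l < N) ((alpha l + 1) * x l) *:
      ('X * (1 - 'X) * \prod_(j < N | j != l) (1 - x j *: 'X)).

Definition v (k : nat) : R :=
  sigma (N.+1 - k) (p - 1 :: [seq (p - x j) / x j | j <- enum 'I_N]).

Definition w (k : nat) : R :=
  sigma (N.+1 - k) (-1 :: [seq (p - x j) / x j | j <- enum 'I_N]).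

(* z k l enters the expansion of W with weight alpha_l + 1 alone: the x_l in
   the l-th summand of W completes prod_(j != l) x_j to x_1 ... x_N.  With
   weight (alpha_l + 1) x_l the formula is false: for
   N = 1, k = 2, x_1 = 2, p = 1, alpha_1 = 0, beta_1 = beta_2 = -1 it gives 4,
   while the coefficient of u^2 is 2. *)
Definition z (k : nat) (l : 'I_N) : R :=
  sigma (N.+1 - k)
    (-1 :: p - 1 :: [seq (p - x j) / x j | j <- enum 'I_N & j != l]).

End Expansion.

(* Main.v *)
Require Import Defs.
From mathcomp Require Import all_boot all_order all_algebra.
From mathcomp Require Import reals mpoly.
From mathcomp Require Import ring.

(** Writing t in terms of u = 1 - p t, that is, substituting t = (1 - u) / p,
    turns every linear factor of W into a scalar times a monic factor in u:
    - 1 - t = p^-1 (u + (p - 1)),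
    - - t = p^-1 (u + (-1)),
    - 1 - x_j t = p^-1 x_j (u + (p - x_j) / x_j).
    So each of the three kinds of terms of W becomes p^-(N+1) x_1 ... x_N times
    a product of N + 1 monic linear factors in u; in the l-th term of the sum,
    the weight x_l replaces the factor x_l lost with 1 - x_l t.  The
    coefficients of such a product are the elementary symmetric functions of
    the constants (Vieta's formula, [coef_prod_XaddC]), and these constants are
    the arguments of sigma in v, w and z.  Since W, after the substitution, is
    the polynomial with coefficients e_k, comparing coefficients of u^k gives
    the formula. *)

Import Order.TTheory GRing.Theory Num.Theory.
Local Open Scope ring_scope.

Lemma meval_mesym (R : comNzRingType) (n k : nat) (f : 'I_n -> R) :
  (mesym n R k).@[f] = \sum_(h : {set 'I_n} | #|h| == k) \prod_(i in h) f i.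
Proof.
rewrite /mesym rmorph_sum /=; apply: eq_bigr => h _.
by rewrite rmorph_prod /=; apply: eq_bigr => i _; rewrite mevalXU.
Qed.

(** Vieta's formula for the roots -y: the elementary symmetric polynomial of
    degree j is homogeneous, so negating its arguments produces a sign (-1)^j
    that cancels the one relating roots and coefficients. *)
Lemma coef_prod_XaddC (R : realType) (s : seq R) (k : nat) :
  (k <= size s)%N ->
  (\prod_(y <- s) ('X + y%:P))`_k = sigma (size s - k) s.
Proof.
move=> le_ks.
have lt_j : (size s - k < (size s).+1)%N by rewrite ltnS leq_subr.
pose j := Ordinal lt_j.
have := @mroots_coeff R (size s) (map_tuple -%R (in_tuple s)) j.
rewrite big_map /= subKn // => coefE.
under eq_bigr do rewrite -[_%:P]opprK -polyCN.
rewrite {}coefE /sigma !meval_mesym mulr_sumr.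
apply: eq_bigr => h /eqP cardh.
under eq_bigr do rewrite tnth_map (tnth_nth 0) /=.
by rewrite prodrN cardh mulrA -expr2 sqrr_sign mul1r.
Qed.

(** The polynomial expressing t in the variable u = 1 - p t. *)
Definition unscale {R : realType} (p : R) : {poly R} := p^-1 *: (1 - 'X).

Section Unscale.

Variables (R : realType) (p : R).
Hypothesis p_neq0 : p != 0.

Lemma comp_unscale_base : (1 - p *: 'X) \Po unscale p = 'X.
Proof.
rewrite comp_polyB comp_polyZ comp_polyX rmorph1 /unscale.
by rewrite scalerA divff // scale1r opprB addrC subrK.
Qed.

Lemma comp_unscale_X : 'X \Po unscale p = - (p^-1 *: ('X + (-1)%:P)).
Proof. by rewrite comp_polyX /unscale -scalerN opprD -polyCN opprK addrC. Qed.

Lemma comp_unscale_linear (a : R) : a != 0 ->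
  (1 - a *: 'X) \Po unscale p = (p^-1 * a) *: ('X + ((p - a) / a)%:P).
Proof.
move=> a_neq0.
rewrite comp_polyB comp_polyZ comp_polyX rmorph1 /unscale.
rewrite -!mul_polyC [RHS]mulrDr -[_ * ((p - a) / a)%:P]polyCM.
have -> : p^-1 * a * ((p - a) / a) = 1 - a * p^-1 by field; apply/andP.
by rewrite polyCB !polyCM; ring.
Qed.

Lemma comp_unscale_1subX :
  (1 - 'X) \Po unscale p = p^-1 *: ('X + (p - 1)%:P).
Proof.
have := @comp_unscale_linear 1 (oner_neq0 R).
by rewrite scale1r mulr1 divr1.
Qed.

Lemma comp_unscale_prod (N : nat) (x : 'I_N -> R) (P : pred 'I_N) :
  (forall j, x j != 0) ->
  (\prod_(j < N | P j) (1 - x j *: 'X)) \Po unscale p =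
  (p^-1 ^+ #|P| * \prod_(j < N | P j) x j) *:
    \prod_(y <- [seq (p - x j) / x j | j <- enum 'I_N & P j]) ('X + y%:P).
Proof.
move=> x_neq0.
rewrite rmorph_prod /= big_map big_filter big_enum_cond /=.
under eq_bigr do rewrite comp_unscale_linear //.
by rewrite scaler_prod big_split /= prodr_const.
Qed.

End Unscale.

Theorem lemma4p5 (R : realType) (N : nat) (beta1 beta2 : R)
    (alpha x : 'I_N -> R) (p : R) (e : 'I_N.+2 -> R) :
  (1 <= N)%N ->
  p != 0 ->
  (forall j, x j != 0) ->
  W beta1 beta2 alpha x = \sum_(k < N.+2) e k *: (1 - p *: 'X) ^+ k ->
  forall k : 'I_N.+2,
    e k = (p ^+ N.+1)^-1 * (\prod_(j < N) x j) *
      ((beta1 + 1) * v x p k + (beta2 + 1) * w x p k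
       + \sum_(l < N) (alpha l + 1) * z x p k l).
Proof.
move=> _ p_neq0 x_neq0 WE k.
(* After the substitution, the expansion in powers of u has coefficients e. *)
have -> : e k = (W beta1 beta2 alpha x \Po unscale p)`_k.
  rewrite WE linear_sum /= coef_sum (bigD1 k) //= big1 => [|j j_neqk].
    by rewrite addr0 comp_polyZ rmorphXn /= comp_unscale_base // coefZ coefXn
      eqxx mulr1.
  by rewrite comp_polyZ rmorphXn /= comp_unscale_base // coefZ coefXn val_eqE
    eq_sym (negPf j_neqk) mulr0.
have le_kN : (k <= N.+1)%N by rewrite -ltnS.
have sigmaE (r : seq R) : size r = N.+1 ->
    sigma (N.+1 - k) r = (\prod_(y <- r) ('X + y%:P))`_k.
  by move=> size_r; rewrite coef_prod_XaddC size_r.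
set c := (p ^+ N.+1)^-1 * \prod_(j < N) x j.
have cE : c = p^-1 * (p^-1 ^+ N * \prod_(j < N) x j).
  by rewrite /c -exprVn exprS mulrA.
pose s := [seq (p - x j) / x j | j <- enum 'I_N].
have size_s : size s = N by rewrite size_map size_enum_ord.
have prodE : (\prod_(j < N) (1 - x j *: 'X)) \Po unscale p =
    (p^-1 ^+ N * \prod_(j < N) x j) *: \prod_(y <- s) ('X + y%:P).
  by rewrite comp_unscale_prod // filter_predT cardT size_enum_ord.
have vE : (((1 - 'X) * \prod_(j < N) (1 - x j *: 'X)) \Po unscale p)`_k =
    c * v x p k.
  rewrite comp_polyM comp_unscale_1subX // prodE -scalerAl -scalerAr scalerA.
  by rewrite -cE coefZ /v sigmaE ?big_cons //= size_s.
have wE : (('X * \prod_(j < N) (1 - x j *: 'X)) \Po unscale p)`_k =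
    - (c * w x p k).
  rewrite comp_polyM comp_unscale_X prodE mulNr -scalerAl -scalerAr scalerA.
  by rewrite -cE coefN coefZ /w sigmaE ?big_cons //= size_s.
(* The factor x l is kept here: it completes the product over j != l in c. *)
have zE l : x l * (('X * (1 - 'X) * \prod_(j < N | j != l) (1 - x j *: 'X))
    \Po unscale p)`_k = - (c * z x p k l).
  pose sl := [seq (p - x j) / x j | j <- enum 'I_N & j != l].
  have card_l : #|(fun j : 'I_N => j != l)|.+1 = N.
    by rewrite cardC1 card_ord prednK // (leq_trans _ (ltn_ord l)).
  have size_sl : (size sl).+1 = N.
    rewrite size_map size_filter -sum1_count big_enum_cond /=.
    by rewrite -[RHS]card_l -sum1_card.
  rewrite /z sigmaE /= ?size_sl // !big_cons.
  rewrite !comp_polyM comp_unscale_X comp_unscale_1subX // comp_unscale_prod //.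
  rewrite !mulNr !(=^~ scalerAl, =^~ scalerAr) !scalerA coefN coefZ.
  rewrite -[_ * \prod_(y <- _) _]mulrA mulrN; congr (- _).
  rewrite [LHS]mulrA; congr (_ * _).
  have expN : p^-1 ^+ N = p^-1 * p^-1 ^+ #|(fun j : 'I_N => j != l)|.
    by rewrite -exprS card_l.
  by rewrite cE [in RHS](bigD1 l) //= expN; ring.
rewrite !(comp_polyB, comp_polyZ) linear_sum /= !coefB !coefZ vE wE coef_sum.
under [X in _ - X]eq_bigr => l _ do
  rewrite comp_polyZ coefZ -[_ * x l * _]mulrA zE mulrN mulrCA.
by rewrite sumrN -mulr_sumr; ring.
Qed.
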